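(* Let $n\ge1$, $\mathbf J=\{1,\dots,n\}$, and let $\mathrm{Pass}_n\subset\prod_{\varnothing\ne I\subset\mathbf J}\overline{\Xi(I)}$ be the permutoassociahedron. Then $$\mathrm{Pass}_n=\bigcup_{\mathfrak A}\mathrm{Str}(\mathfrak A),$$ where the union is over all tree-partitions $\mathfrak A$ of $\mathbf J$; that is, the canonical maps $\iota_{\mathfrak A}:\mathrm{Str}(\mathfrak A)\to\prod_{\varnothing\ne I\subset\mathbf J}\overline{\Xi(I)}$ described in the context are injective, have pairwise disjoint images, and the union of their images is $\mathrm{Pass}_n$.
   Context: For a finite nonempty set $I$, $\Xi(I)$ is the vector space of functions $I\to\mathbb R$ modulo constant functions; $\Xi_n:=\Xi(\mathbf J)$. For $K\subset I$ there is the restriction map $\Xi(I)\to\Xi(K)$. For a partition $\mathfrak a$ of $I$ there is the embedding $\Xi(I/\mathfrak a)\to\Xi(I)$, pulling back functions along the quotient map $I\to I/\mathfrak a$. For a finite-dimensional real vector space $V$, $\partial V$ is the sphere at infinity, i.e. the set of rays $\{\lambda v:\lambda>0\}$, $v\ne0$, and $\overline V=V\sqcup\partial V$ is the corresponding compactification of $V$ by a sphere at infinity (homeomorphic to a closed ball; if $V=0$, then $\partial V=\varnothing$). $\partial\Xi(I)^{\mathrm{gen}}\subset\partial\Xi(I)$ is the set of rays of functions $f$ with $f(a)\ne f(b)$ for all $a\ne b$ in $I$. The permutoassociahedron $\mathrm{Pass}_n$ is the closure of the image of the diagonal restriction map $\Xi_n\to\prod_{\varnothing\ne I\subset\mathbf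 J}\Xi(I)\subset\prod_{\varnothing\ne I\subset\mathbf J}\overline{\Xi(I)}$. A tree-partition $\mathfrak A$ of a finite set $\mathbf M$ is a collection of nonempty subsets of $\mathbf M$ such that: (a) $\mathbf M\in\mathfrak A$; (b) any $I_1,I_2\in\mathfrak A$ are disjoint or one contains the other; (c) if $I\supsetneq K$ are elements of $\mathfrak A$, then there are $K_1=K,K_2,\dots,K_\alpha\in\mathfrak A$ pairwise disjoint with $I=\bigcup K_j$. An element $I\in\mathfrak A$ is irreducible if it contains no element of $\mathfrak A$ as a proper subset, and reducible otherwise. A reducible $I\in\mathfrak A$ has a unique minimal decomposition: the partition of $I$ into the maximal elements of $\mathfrak A$ properly contained in $I$. For a tree-partition $\mathfrak A$ of $\mathbf J$ and $K\in\mathfrak A$ put $U_{\mathfrak A}(K)=\Xi(K)$ if $K$ is irreducible, and $U_{\mathfrak A}(K)=\partial\Xi(K/\mathfrak r)^{\mathrm{gen}}$ if $K$ is reducible with minimal decomposition $\mathfrak r$. The stratum is $\mathrm{Str}(\mathfrak A)=\prod_{K\in\mathfrak A}U_{\mathfrak A}(K)$. The map $\iota_{\mathfrak A}$: for $u=(u_K)_{K\in\mathfrak A}\in\mathrm{Str}(\mathfrak A)$ and a nonempty $L\subset\mathbf J$, let $K$ be the minimal element of $\mathfrak A$ containing $L$. The $L$-component of $\iota_{\mathfrak A}(u)$ is: if $K$ is irreducible, the image of $u_K\in\Xi(K)$ in $\Xi(L)$ under restriction; if $K$ is reducible with minimal decomposition $\mathfrak r$, the image of $u_K$ under $\partial\Xi(K/\mathfrak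 r)^{\mathrm{gen}}\to\partial\Xi(K)$ (induced by the embedding) followed by the map to $\partial\Xi(L)$ induced by restriction (defined since the function is not constant on $L$). *)

(* Defs.v *)
From HB Require Import structures.
From mathcomp Require Import all_boot all_order all_algebra.

Set Implicit Arguments.
Unset Strict Implicit.
Unset Printing Implicit Defensive.

Import Order.TTheory GRing.Theory Num.Theory.

(* Used for a subset K of M and, with T := {set M}, for the set of blocks of a
   partition P of K, so that elt P is the quotient K / P. *)
Definition elt (T : finType) (K : {set T}) : finType := {x : T | x \in K}.

Definition nonempty_subset (T : finType) : finType := {K : {set T} | K != set0}.

Section SubsetMaps.
Variable T : finType.
Implicit Types (K L : {set T}) (P : {set {set T}}).

Definition elt_incl L K (LK : L \subset K) (x : elt L) : elt K :=
  exist _ (val x) (subsetP LK _ (valP x)).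

Lemma pblock_block P K (PK : partition P K) (x : elt K) :
  pblock P (val x) \in P.
Proof. by rewrite pblock_mem // (cover_partition PK) (valP x). Qed.

Definition quotient_map P K (PK : partition P K) (x : elt K) : elt P :=
  exist _ (pblock P (val x)) (pblock_block PK x).

Lemma quotient_map_surj P K (PK : partition P K) (B : elt P) :
  exists x, quotient_map PK x = B.
Proof.
have BP : val B \in P := valP B.
have /set0Pn [x xB] : val B != set0 := partition_neq0 PK BP.
have xK : x \in K by apply: (subsetP (partitionS PK BP)).
exists (exist _ x xK); apply: val_inj => /=.
exact: (def_pblock (partition_trivIset PK) BP xB).
Qed.

End SubsetMaps.

Section TreePartitions.
Variable T : finType.
Implicit Types (A P : {set {set T}}) (B C I K L : {set T}).

Record tree_partition A : Prop := TreePartition {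
  tree_neq0 : forall K, K \in A -> K != set0;
  tree_full : [set: T] \in A;
  tree_laminar : forall I K, I \in A -> K \in A ->
    [\/ [disjoint I & K], I \subset K | K \subset I];
  tree_split : forall I K, I \in A -> K \in A -> K \proper I ->
    exists P, [/\ P \subset A, K \in P & partition P I] }.

Definition irreducible_elt A K : bool := ~~ [exists B in A, B \proper K].

Definition min_decomp A K : {set {set T}} :=
  [set B | maxset (fun C => (C \in A) && (C \proper K)) B].

(* Minimality for inclusion is min_elt_sub below. *)
Definition min_elt A L : {set T} :=
  [arg min_(K < [set: T] | (K \in A) && (L \subset K)) #|K|]%N.

Section Theory.
Variables (A : {set {set T}}) (treeA : tree_partition A).

Lemma tree_laminar_meet I K x : I \in A -> K \in A -> x \in I -> x \in K ->
  I \subset K \/ K \subset I.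
Proof.
move=> IA KA xI xK; case: (tree_laminar treeA IA KA); [|by left|by right].
by move=> /disjointFr/(_ xI); rewrite xK.
Qed.

Lemma min_decompP K B :
  B \in min_decomp A K ->
  [/\ B \in A, B \proper K &
      forall C, C \in A -> C \proper K -> B \subset C -> C = B].
Proof.
rewrite inE => /maxsetP [/andP [BA BK] Bmax]; split=> // C CA CK.
by apply: Bmax; rewrite CA.
Qed.

Lemma min_decomp_partition K :
  K \in A -> ~~ irreducible_elt A K -> partition (min_decomp A K) K.
Proof.
move=> KA /negPn/existsP [B /andP [BA BK]].
have [P [PA BP partP]] := tree_split treeA KA BA BK.
apply/and3P; split.
- apply/eqP/setP => x; apply/bigcupP/idP => [[C]|xK].
    by move=> /min_decompP [_ /proper_sub/subsetP CK _]; apply: CK.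
  have [D DP xD] : exists2 D, D \in P & x \in D.
    by move: xK; rewrite -(cover_partition partP) => /bigcupP [D]; exists D.
  have DA : D \in A := subsetP PA _ DP.
  have DK : D \proper K.
    rewrite properEneq (partitionS partP DP) andbT; apply/eqP => DE.
    have DB : D != B by apply: contraTneq BK => <-; rewrite DE properxx.
    have /trivIsetP/(_ _ _ DP BP DB) := partition_trivIset partP.
    have /set0Pn [y yB] := tree_neq0 treeA BA.
    have yD : y \in D by rewrite DE; apply: (subsetP (proper_sub BK)).
    by move=> /disjointFr/(_ yD); rewrite yB.
  have [C Cmax DC] := @maxset_exists _ (fun C => (C \in A) && (C \proper K)) D
    (introT andP (conj DA DK)).
  by exists C; [rewrite inE | apply: (subsetP DC)].
- apply/trivIsetP => C D /min_decompP [CA CK Cmax] /min_decompP [DA DK Dmax] CD.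
  rewrite disjoint_subset; apply/subsetP => x xC; apply/negP => xD.
  move/eqP: CD; apply.
  by case: (tree_laminar_meet CA DA xC xD) => [/Cmax->//|/Dmax->].
- by apply/negP => /min_decompP [/(tree_neq0 treeA)]; rewrite eqxx.
Qed.

Lemma min_eltP L :
  [/\ min_elt A L \in A, L \subset min_elt A L &
      forall K, K \in A -> L \subset K -> #|min_elt A L| <= #|K|].
Proof.
rewrite /min_elt; case: arg_minnP => [|K /andP [KA LK] Kmin].
  by rewrite (tree_full treeA) subsetT.
by split=> // C CA LC; apply: Kmin; rewrite CA.
Qed.

Lemma min_elt_mem L : min_elt A L \in A. Proof. by case: (min_eltP L). Qed.

Lemma min_elt_subset L : L \subset min_elt A L.
Proof. by case: (min_eltP L). Qed.

Lemma min_elt_sub L K : L != set0 -> K \in A -> L \subset K ->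
  min_elt A L \subset K.
Proof.
case/set0Pn => x xL KA LK; have [EA LE Emin] := min_eltP L.
case: (tree_laminar_meet EA KA (subsetP LE _ xL) (subsetP LK _ xL)) => //.
by move=> KE; have /eqP -> : K == min_elt A L by rewrite eqEcard KE Emin.
Qed.

Lemma min_elt_meets_two_blocks L (L0 : L != set0)
    (red : ~~ irreducible_elt A (min_elt A L)) :
  exists x y : elt L,
    let q := quotient_map (min_decomp_partition (min_elt_mem L) red) in
    let i := elt_incl (min_elt_subset L) in
    q (i x) != q (i y).
Proof.
have /set0Pn [x xL] := L0; set K := min_elt A L in red *.
have part := min_decomp_partition (min_elt_mem L) red.
have xK : x \in K := subsetP (min_elt_subset L) _ xL.
have : ~~ (L \subset pblock (min_decomp A K) x).
  apply/negP => LB.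
  have /min_decompP [BA BK _] : pblock (min_decomp A K) x \in min_decomp A K.
    by rewrite pblock_mem // (cover_partition part).
  by move: (min_elt_sub L0 BA LB); apply/negP; case/properP: BK => _ [z zK zB];
     apply: contra zB => /subsetP; apply.
case/subsetPn => y yL yB.
exists (exist _ x xL), (exist _ y yL) => /=; rewrite -val_eqE /=.
apply: contra yB => /eqP -> /=.
by rewrite mem_pblock (cover_partition part) (subsetP (min_elt_subset L)).
Qed.

End Theory.
End TreePartitions.

Definition treepart (T : finType) : Type :=
  {A : {set {set T}} | tree_partition A}.

From mathcomp Require Import all_classical all_reals all_analysis.
Import numFieldTopology.Exports.

Local Open Scope classical_set_scope.
Local Open Scope ring_scope.
Local Open Scope quotient_scope.

Section Sphere.
Variable R : realType.

Definition ray (V : lmodType R) (v : V) : set V :=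
  [set t *: v | t in [set t : R | 0 < t]].

Definition sphere_at_infinity (V : lmodType R) : Type :=
  {r : set V | exists2 v, v != 0 & r = ray v}.

Definition ray_at (V : lmodType R) (v : V) (v0 : v != 0) :
    sphere_at_infinity V :=
  exist _ (ray v) (ex_intro2 _ _ v v0 erefl).

Section Map.
Variables (V W : lmodType R) (f : {linear V -> W}).

Lemma image_ray v : f @` ray v = ray (f v).
Proof.
rewrite eqEsubset; split=> [_ [_ [t t0 <-] <-]|_ [t t0 <-]].
  by exists t => //; rewrite linearZ.
by exists (t *: v); [exists t | rewrite linearZ].
Qed.

Lemma sphere_map_proof (r : sphere_at_infinity V) :
  (forall v, sval r v -> f v != 0) ->
  exists2 w, w != 0 & f @` sval r = ray w.
Proof.
case: r => r [v v0 rE] /= fv0; exists (f v); last by rewrite rE image_ray.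
by apply: fv0; rewrite rE; exists 1; rewrite ?scale1r //=.
Qed.

Definition sphere_map (r : sphere_at_infinity V)
    (fr : forall v, sval r v -> f v != 0) : sphere_at_infinity W :=
  exist _ (f @` sval r) (sphere_map_proof fr).

End Map.

Inductive compactification (V : lmodType R) : Type :=
  | FinitePoint of V
  | InfinitePoint of sphere_at_infinity V.

End Sphere.

Section CompactificationTopology.
Variables (R : realType) (V : preTopologicalLmodType R).
Local Notation Vbar := (compactification V).

HB.instance Definition _ := gen_eqMixin Vbar.
HB.instance Definition _ := gen_choiceMixin Vbar.

(* For finite-dimensional V this is the topology of the closed ball, transported
   along v |-> v / (1 + |v|) (with rays sent to the unit sphere): the
   neighbourhoods of the ray of v are the sets containing, for some
   neighbourhood W of v and some s, all t *: w and all rays of nonzero w, with w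
   in W and t > s. *)
Definition compactification_open (U : set Vbar) : Prop :=
  open [set v : V | U (FinitePoint v)] /\
  forall (v : V) (v0 : v != 0), U (InfinitePoint (ray_at v0)) ->
    \forall w \near v & t \near +oo,
      U (FinitePoint (t *: w)) /\
      forall w0 : w != 0, U (InfinitePoint (ray_at w0)).

Let near_ray_filter (v : V) : Filter (filter_prod (nbhs v) (pinfty_nbhs R)).
Proof. exact: filter_prod_filter. Qed.

Lemma compactification_openT : compactification_open setT.
Proof.
by split=> [|v v0 _]; [exact: openT | exact: filterE].
Qed.

Lemma compactification_openI : setI_closed compactification_open.
Proof.
move=> U U' [oU infU] [oU' infU']; split=> [|v v0 [Uv U'v]]; first exact: openI.
move: (infU _ _ Uv) (infU' _ _ U'v).
apply: (@filterS2 _ _ (near_ray_filter v)) => -[w t] /= [? ?] [? ?].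
by split=> [|w0]; split; auto.
Qed.

Lemma compactification_open_bigcup (I : Type) (f : I -> set Vbar) :
  (forall i, compactification_open (f i)) ->
  compactification_open (\bigcup_i f i).
Proof.
move=> fo; split=> [|v v0 [i _ fv]].
  have -> : [set v : V | (\bigcup_i f i) (FinitePoint v)] =
            \bigcup_i [set v : V | f i (FinitePoint v)] by [].
  by apply: bigcup_open => i _; case: (fo i).
have [_ /(_ _ _ fv)] := fo i.
apply: (@filterS _ _ (near_ray_filter v)) => -[w t] /= [fw fray].
by split=> [|w0]; exists i; rewrite ?fray.
Qed.

HB.instance Definition _ := isOpenTopological.Build Vbar
  compactification_openT compactification_openI compactification_open_bigcup.

End CompactificationTopology.

Section Xi.
Variable R : realType.

Definition funs (I : Type) : Type := {ptws I -> R^o}.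

HB.instance Definition _ (I : Type) := Topological.on (funs I).
HB.instance Definition _ (I : Type) :=
  GRing.Lmodule.copy (funs I) (I -> R^o).

Definition constant_funs (I : Type) : {pred funs I} :=
  [pred f | `[< exists c : R, f = cst c >]].
Arguments constant_funs : clear implicits.

Lemma constant_funs_zmod_closed (I : Type) : zmod_closed (constant_funs I).
Proof.
split; first by apply/asboolP; exists 0.
move=> f g /asboolP [c ->] /asboolP [d ->]; apply/asboolP.
by exists (c - d); apply/funext.
Qed.

HB.instance Definition _ (I : Type) :=
  GRing.isZmodClosed.Build (funs I) (constant_funs I)
    (@constant_funs_zmod_closed I).

Definition Xi (I : Type) : Type := Quotient.quot (constant_funs I).

HB.instance Definition _ (I : Type) :=
  GRing.Zmodule.copy (Xi I) (Quotient.quot (constant_funs I)).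

Section Instances.
Variable I : Type.
Implicit Types (f g : funs I) (x y : Xi I) (a b : R).

Definition to_Xi f : Xi I := \pi_(Quotient.quot (constant_funs I)) f.
Definition Xi_repr x : funs I := repr (x : Quotient.quot (constant_funs I)).

(* quotient_topology is not used because its choice structure clashes with the
   one underlying the additive group Quotient.quot. *)
Definition Xi_open (U : set (Xi I)) : Prop := open (to_Xi @^-1` U).

Lemma Xi_openT : Xi_open setT.
Proof. exact: openT. Qed.
Lemma Xi_openI : setI_closed Xi_open.
Proof. by move=> U V; exact: openI. Qed.
Lemma Xi_open_bigcup (J : Type) (U : J -> set (Xi I)) :
  (forall j, Xi_open (U j)) -> Xi_open (\bigcup_j U j).
Proof. by move=> oU; apply: bigcup_open => j _; exact: oU. Qed.

Lemma Xi_reprK : cancel Xi_repr to_Xi.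
Proof. exact: reprK. Qed.

Lemma to_XiP f g : to_Xi f = to_Xi g <-> exists c : R, f - g = cst c.
Proof.
have E : (f - g \in constant_funs I) = (to_Xi f == to_Xi g).
  exact: Quotient.idealrBE.
split=> [/eqP|fg]; first by rewrite -E => /asboolP.
by apply/eqP; rewrite -E; apply/asboolP.
Qed.

Lemma to_XiD f g : to_Xi (f + g) = to_Xi f + to_Xi g.
Proof. exact: raddfD (\pi_(Quotient.quot (constant_funs I))) f g. Qed.

Definition Xi_scale a x : Xi I := to_Xi (a *: Xi_repr x).

Lemma Xi_scale_pi a f : Xi_scale a (to_Xi f) = to_Xi (a *: f).
Proof.
apply/to_XiP; have /to_XiP [c fE] := Xi_reprK (to_Xi f).
by exists (a * c); rewrite -scalerBr fE; apply/funext.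
Qed.

Lemma Xi_scaleA a b x : Xi_scale a (Xi_scale b x) = Xi_scale (a * b) x.
Proof. by rewrite -[x]Xi_reprK !Xi_scale_pi scalerA. Qed.
Lemma Xi_scale1 : left_id 1 Xi_scale.
Proof. by move=> x; rewrite -[x]Xi_reprK !Xi_scale_pi scale1r. Qed.
Lemma Xi_scaleDr : right_distributive Xi_scale +%R.
Proof.
move=> a x y; rewrite -[x]Xi_reprK -[y]Xi_reprK.
by rewrite -to_XiD !Xi_scale_pi scalerDr to_XiD.
Qed.
Lemma Xi_scaleDl x : {morph Xi_scale^~ x : a b / a + b}.
Proof.
by move=> a b; rewrite -[x]Xi_reprK !Xi_scale_pi scalerDl to_XiD.
Qed.

End Instances.

HB.instance Definition _ (I : Type) := isOpenTopological.Build (Xi I)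
  (@Xi_openT I) (@Xi_openI I) (@Xi_open_bigcup I).
HB.instance Definition _ (I : Type) :=
  GRing.Zmodule_isLmodule.Build R (Xi I)
    (@Xi_scaleA I) (@Xi_scale1 I) (@Xi_scaleDr I) (@Xi_scaleDl I).

Lemma to_XiZ (I : Type) a (f : funs I) : to_Xi (a *: f) = a *: to_Xi f.
Proof. by rewrite -Xi_scale_pi. Qed.

Section Pullback.
Variables (I K : Type) (phi : K -> I).

Definition Xi_pullback (x : Xi I) : Xi K := to_Xi (Xi_repr x \o phi).

Lemma Xi_pullback_pi f : Xi_pullback (to_Xi f) = to_Xi (f \o phi).
Proof.
apply/to_XiP; have /to_XiP [c fE] := Xi_reprK (to_Xi f).
by exists c; apply/funext => k; exact: (congr1 (@^~ (phi k)) fE).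
Qed.

Lemma Xi_pullback_linear : linear Xi_pullback.
Proof.
move=> a x y; rewrite -[x]Xi_reprK -[y]Xi_reprK.
by rewrite -to_XiZ -to_XiD !Xi_pullback_pi -to_XiZ -to_XiD.
Qed.

HB.instance Definition _ :=
  GRing.isLinear.Build R (Xi I) (Xi K) _ Xi_pullback Xi_pullback_linear.

End Pullback.

Lemma to_Xi0 (I : Type) : to_Xi (0 : funs I) = 0.
Proof. by rewrite -(scale0r 0) to_XiZ scale0r. Qed.

Lemma Xi_pullback_surj (I K : Type) (phi : K -> I) (x : Xi I) :
  (forall i, exists k, phi k = i) -> x != 0 -> Xi_pullback phi x != 0.
Proof.
move=> surj; apply: contra => /eqP.
rewrite -[x]Xi_reprK Xi_pullback_pi -!to_Xi0.
case/to_XiP=> c E; apply/eqP/to_XiP; exists c; apply/funext => i.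
by have [k <-] := surj i; exact: (congr1 (@^~ k) E).
Qed.

Definition generic_ray (I : Type) (r : sphere_at_infinity (Xi I)) : Prop :=
  exists2 f : funs I, injective f & sval r = ray (to_Xi f).

Lemma generic_ray_mem (I : Type) (r : sphere_at_infinity (Xi I)) x :
  generic_ray r -> sval r x -> exists2 f, injective f & x = to_Xi f.
Proof.
move=> [f f_inj ->] [t t0 <-]; exists (t *: f); last by rewrite to_XiZ.
by move=> i j /(mulfI (lt0r_neq0 t0)) /f_inj.
Qed.

End Xi.

Arguments Xi : clear implicits.

Section Strata.
Variables (R : realType) (T : finType).
Implicit Types (A : {set {set T}}) (K L : {set T}).

Definition Xi_restrict L K (LK : L \subset K) :
    {linear Xi R (elt K) -> Xi R (elt L)} :=
  @Xi_pullback R _ _ (elt_incl LK).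

Definition Xi_embed (P : {set {set T}}) K (PK : finset.partition P K) :
    {linear Xi R (elt P) -> Xi R (elt K)} :=
  @Xi_pullback R _ _ (quotient_map PK).

(* The ambient product, with the product topology. *)
Definition Xi_product : Type :=
  prod_topology (fun I : nonempty_subset T =>
    compactification (Xi R (elt (val I)))).

HB.instance Definition _ := Topological.on Xi_product.

Definition diagonal (x : Xi R T) : Xi_product :=
  fun I => FinitePoint (Xi_pullback (fun i : elt (val I) => val i) x).

Definition Pass : set Xi_product := closure (range diagonal).

Definition stratum_factor A K : Type :=
  if irreducible_elt A K then Xi R (elt K)
  else {r : sphere_at_infinity (Xi R (elt (min_decomp A K))) | generic_ray r}.

Definition Str (A : treepart T) : Type :=
  forall K : elt (sval A), stratum_factor (sval A) (val K).

Section Iota.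
Variable A : treepart T.
Let treeA := svalP A.

Lemma embed_neq0 (P : {set {set T}}) K (PK : finset.partition P K)
    (r : sphere_at_infinity (Xi R (elt P))) v :
  sval r v -> Xi_embed PK v != 0.
Proof.
case: r => r [w w0 rE] /=; rewrite rE => -[t t0 <-].
apply: Xi_pullback_surj; first exact: quotient_map_surj.
by rewrite scaler_eq0 negb_or w0 gt_eqF.
Qed.

Definition sphere_embed (P : {set {set T}}) K (PK : finset.partition P K)
    (r : sphere_at_infinity (Xi R (elt P))) :
    sphere_at_infinity (Xi R (elt K)) :=
  sphere_map (@embed_neq0 P K PK r).

Variables (L : {set T}) (L0 : L != finset.set0).
Let K := min_elt (sval A) L.
Let KA : K \in sval A := min_elt_mem treeA L.
Let LK : L \subset K := min_elt_subset treeA L.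

Lemma restrict_neq0 (red : ~~ irreducible_elt (sval A) K)
    (r : sphere_at_infinity (Xi R (elt (min_decomp (sval A) K)))) :
  generic_ray r ->
  forall v, sval (sphere_embed (min_decomp_partition treeA KA red) r) v ->
  Xi_restrict LK v != 0.
Proof.
move=> gr _ [w rw <-]; have [f f_inj ->] := generic_ray_mem gr rw.
have [x [y]] := min_elt_meets_two_blocks treeA L0 red; rewrite /= => /eqP xy.
rewrite /Xi_restrict /Xi_embed /= (Xi_pullback_pi _ f) Xi_pullback_pi -to_Xi0.
apply/eqP => /to_XiP [c].
rewrite subr0 => E; apply/xy/f_inj.
exact: etrans (congr1 (@^~ x) E) (esym (congr1 (@^~ y) E)).
Qed.

Definition iota_irreducible (u : Xi R (elt K)) :
    compactification (Xi R (elt L)) :=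
  FinitePoint (Xi_restrict LK u).

Definition iota_reducible (red : ~~ irreducible_elt (sval A) K)
    (u : {r : sphere_at_infinity (Xi R (elt (min_decomp (sval A) K)))
         | generic_ray r}) :
    compactification (Xi R (elt L)) :=
  InfinitePoint (sphere_map (@restrict_neq0 red (sval u) (svalP u))).

Definition iota_branch (b : bool) :
    irreducible_elt (sval A) K = b ->
    (if b then Xi R (elt K)
     else {r : sphere_at_infinity (Xi R (elt (min_decomp (sval A) K)))
          | generic_ray r}) ->
    compactification (Xi R (elt L)) :=
  match b with
  | true => fun=> iota_irreducible
  | false => fun red => iota_reducible (negbT red)
  end.

Definition iota_component :
    stratum_factor (sval A) K -> compactification (Xi R (elt L)) :=
  iota_branch erefl.

End Iota.

Definition iota_Str (A : treepart T) (u : Str A) : Xi_product :=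
  fun I => iota_component (valP I)
    (u (exist _ (min_elt (sval A) (val I)) (min_elt_mem (svalP A) (val I)))).

End Strata.

Arguments Pass : clear implicits.
Arguments Str R {T} A.
Arguments iota_Str R {T} A u.

(* Main.v *)
Require Import Defs.
From HB Require Import structures.
From mathcomp Require Import all_boot all_order all_algebra.
From mathcomp Require Import all_classical all_reals all_analysis.
From mathcomp Require Import ring lra.

(* A point p of the closure is finite or infinite on each nonempty subset, and
   by continuity of restriction a finite value restricts to smaller subsets, as
   does an infinite one that stays nonconstant there.  The tree-partition of p
   consists of the sets K such that p is infinite, and constant on K, on every
   proper superset of K: a point of the stratum of A determines A in this way,
   and conversely the level sets of the infinite components of p make this
   family a tree-partition whose stratum contains p.  In the other direction, the
   point u of a stratum is the limit, as t tends to infinity, of the functions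
   sum_K t^(w(K)) u_K, with w(K) = 0 for K irreducible and w(K) = #|K| for K
   reducible: on a set L with minimal element K, the terms above K are constant
   and those below K are negligible. *)

Set Implicit Arguments.
Unset Strict Implicit.
Unset Printing Implicit Defensive.

Import Order.TTheory GRing.Theory Num.Theory.
Import numFieldTopology.Exports.

Local Open Scope classical_set_scope.
Local Open Scope ring_scope.

(** * Convergence in products and of finite sums *)

Lemma prod_topology_cvg (I : Type) (T : I -> topologicalType)
    (F : set_system (prod_topology T)) {FF : Filter F} (p : prod_topology T) :
  (forall i, (fun g => g i) @ F --> p i) -> F --> p.
Proof.
move=> Fp; apply/cvg_sup => i U; rewrite nbhsE => -[_ [[B oB <-] Bp] BU].
apply: filterS BU _; apply: (Fp i B); exact: open_nbhs_nbhs.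
Qed.

Lemma cvgr_sum (R : realType) (S J : Type) (F : set_system S) {FF : Filter F}
    (r : seq J) (P : pred J) (f : J -> S -> R) (a : J -> R) :
  (forall j, P j -> f j @ F --> a j) ->
  (fun s => \sum_(j <- r | P j) f j s) @ F --> \sum_(j <- r | P j) a j.
Proof.
move=> fa; elim: r => [|j r IHr].
  rewrite big_nil; under eq_fun do rewrite big_nil; exact: cvg_cst.
rewrite big_cons; under eq_fun do rewrite big_cons.
case: ifP => [Pj|_]; last exact: IHr.
exact: (@cvgD R R^o _ _ _ _ _ _ _ (fa j Pj) IHr).
Qed.

(** * Coordinate differences and a norm on [Xi R I] *)

Section XiTopology.
Variables (R : realType) (I : finType).
Implicit Types (x y v w : Xi R I) (f : funs R I).

Lemma continuous_to_Xi : continuous (@to_Xi R I).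
Proof. by apply/continuousP => U oU. Qed.

Lemma continuous_Xi (S : topologicalType) (h : Xi R I -> S) :
  continuous (h \o @to_Xi R I) -> continuous h.
Proof. by move=> /continuousP ch; apply/continuousP => U oU; exact: ch. Qed.

Lemma continuous_eval (i : I) : continuous (fun f : funs R I => f i : R).
Proof. exact: (@proj_continuous I (fun=> R^o) i). Qed.

Lemma to_Xi_cvg (S : Type) (F : set_system S) {FF : Filter F}
    (h : S -> funs R I) f :
  (forall i, (fun s => h s i : R) @ F --> (f i : R)) ->
  (fun s => to_Xi (h s)) @ F --> to_Xi f.
Proof.
move=> hf; have hF : h @ F --> f.
  by apply: (@prod_topology_cvg I (fun=> R^o) (h @ F) _ f) => i; exact: hf.
exact: cvg_comp hF (@continuous_to_Xi f).
Qed.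

(** Differences of values do not see added constants: they serve as linear coordinates and jointly
    separate points. *)
Definition Xi_diff (i j : I) x : R := Xi_repr x i - Xi_repr x j.

Lemma Xi_diff_pi i j f : Xi_diff i j (to_Xi f) = f i - f j.
Proof.
have /to_XiP [c fE] := Xi_reprK (to_Xi f).
have E k : Xi_repr (to_Xi f) k = f k + c.
  apply/eqP; rewrite addrC -subr_eq; apply/eqP.
  exact: (congr1 (fun g : I -> R => g k) fE).
by rewrite /Xi_diff !E opprD addrACA subrr addr0.
Qed.

Lemma Xi_diffZ i j t x : Xi_diff i j (t *: x) = t * Xi_diff i j x.
Proof. by rewrite -[x]Xi_reprK -to_XiZ !Xi_diff_pi -mulrBr. Qed.

Lemma Xi_diff0 i j : Xi_diff i j 0 = 0.
Proof. by rewrite -to_Xi0 Xi_diff_pi subrr. Qed.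

Lemma Xi_diff_inj x y : (forall i j, Xi_diff i j x = Xi_diff i j y) -> x = y.
Proof.
rewrite -[x]Xi_reprK -[y]Xi_reprK => E; apply/to_XiP.
have [[i0]|I0] := pselect (inhabited I); last first.
  by exists 0; apply/funext => i; case: I0.
exists (Xi_repr x i0 - Xi_repr y i0); apply/funext => i.
have := E i i0; rewrite !Xi_diff_pi => Ei.
change (Xi_repr x i - Xi_repr y i = Xi_repr x i0 - Xi_repr y i0); lra.
Qed.

(** Exchanging [i] and [j] reverses the sign of a difference, so the inequality can be had in the
    prescribed direction. *)
Lemma Xi_diff_lt x y : x != y -> exists i j, Xi_diff i j x < Xi_diff i j y.
Proof.
move=> /eqP xy; apply: contrapT => /forallNP nlt; apply: xy.
have le i j : Xi_diff i j y <= Xi_diff i j x.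
  by rewrite leNgt; apply/negP => ltij; apply: (nlt i); exists j.
apply: Xi_diff_inj => i j; apply/eqP; rewrite eq_le le andbT.
have := le j i; rewrite -[x]Xi_reprK -[y]Xi_reprK !Xi_diff_pi; lra.
Qed.

Lemma continuous_Xi_diff i j : continuous (Xi_diff i j).
Proof.
apply: continuous_Xi.
have -> : Xi_diff i j \o @to_Xi R I = fun f => f i - f j.
  by apply/funext => g; exact: Xi_diff_pi.
move=> f.
exact: (@cvgB R R^o _ _ _ _ _ _ _ (@continuous_eval i f) (@continuous_eval j f)).
Qed.

Definition Xi_norm x : R := \sum_(ij : I * I) `|Xi_diff ij.1 ij.2 x|.

Lemma Xi_norm_eq0 x : (Xi_norm x == 0) = (x == 0).
Proof.
apply/idP/eqP => [|->].
  rewrite psumr_eq0 // => /allP N0; apply: Xi_diff_inj => i j.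
  rewrite Xi_diff0; apply/eqP; rewrite -normr_eq0.
  exact: (implyP (N0 (i, j) (mem_index_enum _))).
by rewrite /Xi_norm big1 // => ij _; rewrite Xi_diff0 normr0.
Qed.

Lemma Xi_norm_ge0 x : 0 <= Xi_norm x.
Proof. exact: sumr_ge0. Qed.

Lemma Xi_norm_gt0 x : (0 < Xi_norm x) = (x != 0).
Proof. by rewrite lt_neqAle Xi_norm_ge0 andbT eq_sym Xi_norm_eq0. Qed.

Lemma Xi_normZ t x : 0 < t -> Xi_norm (t *: x) = t * Xi_norm x.
Proof.
move=> t0; rewrite mulr_sumr; apply: eq_bigr => ij _.
by rewrite Xi_diffZ normrM gtr0_norm.
Qed.

Lemma continuous_Xi_norm : continuous Xi_norm.
Proof.
move=> x; apply: (@cvgr_sum R _ _ (nbhs x) _) => ij _.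
exact: (@cvg_norm R R^o _ _ _ _ _ (@continuous_Xi_diff _ _ x)).
Qed.

Lemma open_Xi_neq0 : open [set x : Xi R I | x != 0].
Proof.
rewrite (_ : [set _ | _] = Xi_norm @^-1` [set r | 0 < r]).
  by apply: open_comp (@open_gt _ _) => x _; exact: continuous_Xi_norm.
by apply/funext => x /=; rewrite Xi_norm_gt0.
Qed.

End XiTopology.

Lemma continuous_Xi_pullback (R : realType) (I K : finType) (phi : K -> I) :
  continuous (@Xi_pullback R _ _ phi).
Proof.
apply: continuous_Xi => f.
rewrite /continuous_at /comp Xi_pullback_pi.
under eq_fun do rewrite Xi_pullback_pi.
exact: (@to_Xi_cvg R K _ (nbhs f) _ (fun g => g \o phi) (f \o phi)
  (fun k => @continuous_eval R I (phi k) f)).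
Qed.

(** * Rays and points at infinity *)

Lemma ray_mem (R : realType) (V : lmodType R) (v : V) : ray v v.
Proof. by exists 1; rewrite ?scale1r //=. Qed.

Lemma rayP (R : realType) (V : lmodType R) (v w : V) :
  ray v = ray w <-> exists2 t, 0 < t & w = t *: v.
Proof.
split=> [vw|[t t0 ->]].
  by have := ray_mem w; rewrite -vw => -[t t0 <-]; exists t.
rewrite eqEsubset; split=> [_ [s s0 <-]|_ [s s0 <-]] /=.
  exists (s / t); first exact: divr_gt0.
  by rewrite scalerA divfK // gt_eqF.
by exists (s * t); [exact: mulr_gt0 | rewrite scalerA].
Qed.

Lemma sphere_eq (R : realType) (V : lmodType R) (r s : sphere_at_infinity V) :
  sval r = sval s -> r = s.
Proof.
by case: r s => r Pr [s Ps] /= rs; subst s; congr exist; exact: Prop_irrelevance.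
Qed.

Lemma sphereP (R : realType) (V : lmodType R) (r : sphere_at_infinity V) :
  exists v (v0 : v != 0), r = ray_at v0.
Proof.
by have [v v0 rE] := svalP r; exists v, v0; exact: sphere_eq.
Qed.

(** * Open subsets of the compactification *)

Section Compactification.
Variables (R : realType) (V : preTopologicalLmodType R).
Local Notation Vbar := (compactification V).

Definition finite_part (U : set V) : set Vbar :=
  [set p | if p is FinitePoint x then U x else False].

Lemma open_finite_part (U : set V) :
  open U -> open (finite_part U).
Proof. by move=> oU; split. Qed.

(** Meant for positively homogeneous [phi]: its sign on a ray is then well defined, and only the
    sign counts at infinity, because [phi (t *: v)] exceeds every [c] for large [t] once [phi v] is
    positive. *)
Definition halfspace (phi : V -> R) (c : R) : set Vbar :=
  [set p | match p with
           | FinitePoint x => c < phi x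
           | InfinitePoint r => exists2 v, sval r v & 0 < phi v
           end].

Lemma open_halfspace (phi : V -> R) (c : R) : continuous phi ->
  (forall t x, 0 < t -> phi (t *: x) = t * phi x) -> open (halfspace phi c).
Proof.
move=> cphi homphi; split.
  by apply: open_comp (@open_gt _ _) => x _; exact: cphi.
move=> v v0 /= [_ [s s0 <-]]; rewrite homphi // pmulr_rgt0 // => phiv.
have phi2 : phi v / 2 < phi v by lra.
(* The two bounds multiply to [|c|], so [t * phi w] exceeds [c]. *)
exists ([set w | phi v / 2 < phi w], [set t | 2 * `|c| / phi v < t]) => /=.
  split; last by exists (2 * `|c| / phi v); split; rewrite ?num_real.
  exact: (cphi v _ (open_nbhs_nbhs (conj (@open_gt R _) phi2))).
move=> [w t] /= [phiw tc].
have t0 : 0 < t by apply: le_lt_trans tc; rewrite divr_ge0 ?mulr_ge0 // ltW.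
split=> [|w0]; last by exists w; [exact: ray_mem | lra].
rewrite homphi //; apply: le_lt_trans (ler_norm c) _.
move: tc; rewrite ltr_pdivrMr // => tc; nra.
Qed.

End Compactification.

(** * Separation of points, and continuity of pullback up to infinity *)

Section XiCompactification.
Variable R : realType.

(** Two finite points are separated by a coordinate difference; a finite point [x] is separated from
    infinity by the level [N x + 1] of the norm. *)
Lemma hausdorff_compactification_Xi (I : finType) :
  hausdorff_space (compactification (Xi R I)).
Proof.
pose N := @Xi_norm R I.
have oN c := @open_halfspace R (Xi R I) N c (@continuous_Xi_norm R I)
  (fun t x => @Xi_normZ R I t x).
have oF c : open (finite_part [set x | N x < c]).
  apply: open_finite_part; apply: open_comp (@open_lt _ _) => x _.
  exact: continuous_Xi_norm.
have NF c : finite_part [set x | N x < c] `&` halfspace N c = set0.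
  rewrite -subset0 => -[x|r] [] //= xc cx.
  by have := lt_trans xc cx; rewrite ltxx.
pose sep p q := exists U V : set (compactification (Xi R I)),
  [/\ open U, open V, U p, V q & U `&` V = set0].
have sepC p q : sep p q -> sep q p.
  by move=> [U [V [oU oV Up Vq UV]]]; exists V, U; rewrite setIC.
have FF x y : x != y -> sep (FinitePoint x) (FinitePoint y).
  case/Xi_diff_lt => i [j].
  set d := Xi_diff i j => dxy; pose c := (d x + d y) / 2.
  have [dxc dcy] : d x < c /\ c < d y by rewrite /c; split; lra.
  exists (finite_part [set z | d z < c]), (finite_part [set z | c < d z]).
  split=> //.
  - apply: open_finite_part; apply: open_comp (@open_lt _ _) => z _.
    exact: continuous_Xi_diff.
  - apply: open_finite_part; apply: open_comp (@open_gt _ _) => z _.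
    exact: continuous_Xi_diff.
  - rewrite -subset0 => -[z|r] [] //= zc cz.
    by have := lt_trans zc cz; rewrite ltxx.
have FI x r : sep (FinitePoint x) (InfinitePoint r).
  have [v [v0 ->]] := sphereP r.
  exists (finite_part [set y | N y < N x + 1]), (halfspace N (N x + 1)).
  split=> //=; first by rewrite ltrDl.
  by exists v; [exact: ray_mem | rewrite Xi_norm_gt0].
(* Normalizing by N, two distinct rays are separated by some coordinate
   difference d, i.e. by the sign of the homogeneous function d - c N. *)
have II r s : r <> s -> sep (InfinitePoint r) (InfinitePoint s).
  have [v [v0 ->]] := sphereP r; have [w [w0 ->]] := sphereP s => vw.
  have Nv : 0 < N v by rewrite Xi_norm_gt0.
  have Nw : 0 < N w by rewrite Xi_norm_gt0.
  have /Xi_diff_lt [i [j]] : (N v)^-1 *: v != (N w)^-1 *: w.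
    apply/eqP => vwE; apply/vw/sphere_eq/rayP.
    exists (N w / N v); first exact: divr_gt0.
    by rewrite -scalerA vwE scalerA divff ?gt_eqF // scale1r.
  rewrite !Xi_diffZ; set d := Xi_diff i j => ltvw.
  pose c := ((N v)^-1 * d v + (N w)^-1 * d w) / 2.
  have cN : continuous (fun x => c * N x).
    move=> x; exact: (@cvgMl_tmp R _ _ _ N c _ (@continuous_Xi_norm R I x)).
  have cd : continuous d by exact: continuous_Xi_diff.
  exists (halfspace (fun x => c * N x - d x) 0).
  exists (halfspace (fun x => d x - c * N x) 0).
  have dc u : 0 < N u -> d u = ((N u)^-1 * d u) * N u.
    by move=> Nu; rewrite mulrAC mulVf ?mul1r // gt_eqF.
  split=> /=.
  - apply: (@open_halfspace R (Xi R I)) => [x|t x t0].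
      exact: (@cvgB R R^o _ _ _ _ _ _ _ (cN x) (cd x)).
    by rewrite /N /d Xi_normZ // Xi_diffZ; ring.
  - apply: (@open_halfspace R (Xi R I)) => [x|t x t0].
      exact: (@cvgB R R^o _ _ _ _ _ _ _ (cd x) (cN x)).
    by rewrite /N /d Xi_normZ // Xi_diffZ; ring.
  - exists v; first exact: ray_mem.
    by rewrite (dc v Nv) -mulrBl mulr_gt0 // /c; lra.
  - exists w; first exact: ray_mem.
    by rewrite (dc w Nw) -mulrBl mulr_gt0 // /c; lra.
  (* By homogeneity the signs on the ray of [z] are those at [z], where the two functions are
     opposite. *)
  - rewrite -subset0 => -[z|q] [] /=; first by lra.
    have [z [z0 ->]] := sphereP q => -[_ [t1 t10 <-]] + [_ [t2 t20 <-]].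
    rewrite /= in t10 t20.
    rewrite /N /d !Xi_normZ // !Xi_diffZ.
    rewrite mulrCA -mulrBr (mulrCA c) -mulrBr !pmulr_rgt0 //; lra.
rewrite open_hausdorff => p q /eqP pq.
suff [U [V [oU oV Up Vq UV]]] : sep p q.
  by exists (U, V); rewrite ?inE //; split=> //; apply/eqP.
case: p q pq => [x|r] [y|s] pq.
- by apply: FF; apply/eqP => xy; apply: pq; rewrite xy.
- exact: FI.
- exact/sepC/FI.
- by apply: II => rs; apply: pq; rewrite rs.
Qed.

(** Pullback extends continuously to the rays it does not kill, and [q'] is the value of this
    extension at [q]. The preimage of [U'] under this partial map is open because not being killed
    is an open condition. *)
Lemma compactification_pullback_open (I K : finType) (phi : K -> I)
    (q : compactification (Xi R I)) (q' : compactification (Xi R K))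
    (U' : set (compactification (Xi R K))) :
  match q with
  | FinitePoint x => q' = FinitePoint (Xi_pullback phi x)
  | InfinitePoint r => exists2 v, sval r v &
     exists v0 : Xi_pullback phi v != 0, q' = InfinitePoint (ray_at v0)
  end -> open U' -> U' q' ->
  exists U, [/\ open U, U q &
    forall x, U (FinitePoint x) -> U' (FinitePoint (Xi_pullback phi x))].
Proof.
move=> qq' [oU' infU'] U'q'.
have cphi := @continuous_Xi_pullback R I K phi.
have oF : open [set x | U' (FinitePoint (Xi_pullback phi x))].
  by apply: (open_comp _ oU') => x _; exact: cphi.
exists [set p | match p with
  | FinitePoint x => U' (FinitePoint (Xi_pullback phi x))
  | InfinitePoint r => exists2 v, sval r v &
     exists v0 : Xi_pullback phi v != 0, U' (InfinitePoint (ray_at v0))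
  end]; split=> //.
- split=> //= v v0 [_ [t t0 <-] [tv0]].
  have fv0 : Xi_pullback phi v != 0.
    by apply: contra tv0 => /eqP fv; rewrite linearZ /= fv scaler0.
  have -> : ray_at tv0 = ray_at fv0.
    by apply/esym/sphere_eq/rayP; exists t; rewrite // linearZ.
  move=> /infU' [[P Q] /= [Pv Qoo] PQ].
  exists ([set w | P (Xi_pullback phi w) /\ Xi_pullback phi w != 0], Q) => /=.
    split=> //; apply: filterI; first exact: (cphi v).
    exact: (cphi v _ (open_nbhs_nbhs (conj (@open_Xi_neq0 R K) fv0))).
  move=> [w s] /= [[Pw w0] Qs].
  have [Uw Uray] := PQ (Xi_pullback phi w, s) (conj Pw Qs).
  split=> [|w0']; first by rewrite linearZ.
  by exists w; [exact: ray_mem | exists w0; exact: Uray].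
- case: q qq' => [x /= <- //|r] [v rv [v0 q'E]].
  by exists v => //; exists v0; rewrite -q'E.
Qed.

End XiCompactification.

Lemma sphere_ray (R : realType) (V : lmodType R) (s : sphere_at_infinity V) v :
  sval s = ray v -> exists v0 : v != 0, s = ray_at v0.
Proof.
have [w [w0 ->]] := sphereP s => /= /rayP [t t0 vE].
have v0 : v != 0 by rewrite vE scaler_eq0 negb_or w0 gt_eqF.
by exists v0; apply/sphere_eq/rayP; exists t.
Qed.

(** * Points given by functions on [T], and their restriction to smaller subsets *)

Section Restriction.
Variables (R : realType) (T : finType).
Implicit Types (K L M : {set T}) (g h : T -> R).

(* All elements of the spaces Xi (elt K) are represented by functions on the
   whole of T, so that no transport between the types elt K is needed. *)
Definition rst K g : Xi R (elt K) := to_Xi (fun x : elt K => g (val x)).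

Definition finite_at K (q : compactification (Xi R (elt K))) g : Prop :=
  q = FinitePoint (rst K g).

Definition infinite_at K (q : compactification (Xi R (elt K))) g : Prop :=
  exists v0 : rst K g != 0, q = InfinitePoint (ray_at v0).

Lemma rst_eqP K g h :
  rst K g = rst K h <->
  forall x y, x \in K -> y \in K -> g x - g y = h x - h y.
Proof.
split=> [gh x y xK yK|gh].
  have := congr1 (Xi_diff (exist _ x xK : elt K) (exist _ y yK)) gh.
  by rewrite !Xi_diff_pi.
by apply: Xi_diff_inj => -[x xK] [y yK]; rewrite !Xi_diff_pi gh.
Qed.

Lemma rst0 K : rst K (fun=> 0) = 0.
Proof. exact: to_Xi0. Qed.

Lemma rst_neq0P K g :
  rst K g != 0 <-> exists x y, [/\ x \in K, y \in K & g x <> g y].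
Proof.
rewrite -rst0; split=> [/eqP g0|[x [y [xK yK gxy]]]].
  apply: contrapT => cst_g; apply: g0; apply/rst_eqP => x y xK yK.
  rewrite subrr; apply: contrapT => /eqP; rewrite subr_eq0 => /eqP gxy.
  by apply: cst_g; exists x, y.
apply/eqP => /rst_eqP /(_ x y xK yK) /eqP.
by rewrite subrr subr_eq0 => /eqP.
Qed.

Lemma rst_surj K (x : Xi R (elt K)) : exists g, x = rst K g.
Proof.
exists (fun z => oapp (Xi_repr x) 0 (insub z : option (elt K))).
rewrite -[LHS]Xi_reprK /rst; congr to_Xi; apply/funext => z.
by rewrite valK.
Qed.

Lemma rst_pullback M L (ML : M \subset L) g :
  Xi_pullback (elt_incl ML) (rst L g) = rst M g.
Proof. exact: Xi_pullback_pi. Qed.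

Lemma finite_or_infinite_at K (q : compactification (Xi R (elt K))) :
  exists g, finite_at q g \/ infinite_at q g.
Proof.
case: q => [x|r]; first by have [g ->] := rst_surj x; exists g; left.
have [v [+ ->]] := sphereP r; have [g ->] := rst_surj v => v0.
by exists g; right; exists v0.
Qed.

Lemma finite_infinite_at K (q : compactification (Xi R (elt K))) g h :
  finite_at q g -> infinite_at q h -> False.
Proof. by move=> -> []. Qed.

(** Two functions giving the same ray differ on [K] by a positive scaling and an additive
    constant. *)
Lemma infinite_at_level K (q : compactification (Xi R (elt K))) g h x y :
  infinite_at q g -> infinite_at q h -> x \in K -> y \in K ->
  g x = g y -> h x = h y.
Proof.
move=> [g0 ->] [h0 [/rayP [t t0 E]]] xK yK gxy.
have := congr1 (Xi_diff (exist _ x xK : elt K) (exist _ y yK)) E.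
rewrite Xi_diffZ !Xi_diff_pi /= gxy subrr mulr0 => /eqP.
by rewrite subr_eq0 => /eqP.
Qed.

(** Compatibility with restriction holds on the diagonal and passes to the closure: if [p M]
    differed from [q'], disjoint neighbourhoods of the two would pull back to a neighbourhood of
    [p], and a diagonal point in it would have its [M]-component in both. *)
Lemma Pass_restrict (p : Xi_product R T) (L M : nonempty_subset T)
    (ML : val M \subset val L) (q' : compactification (Xi R (elt (val M)))) :
  Pass R T p ->
  match p L with
  | FinitePoint x => q' = FinitePoint (Xi_pullback (elt_incl ML) x)
  | InfinitePoint r => exists2 v, sval r v &
     exists v0 : Xi_pullback (elt_incl ML) v != 0, q' = InfinitePoint (ray_at v0)
  end -> p M = q'.
Proof.
move=> pP qq'; apply/eqP; apply: contrapT => /negP pMq'.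
have := @hausdorff_compactification_Xi R (elt (val M)).
rewrite open_hausdorff => /(_ _ _ pMq') [[V U'] /= [pV qU']] [oV oU' /eqP VU'].
rewrite inE in pV; rewrite inE in qU'.
have [U [oU Up UU']] :=
  @compactification_pullback_open R _ _ _ (p L) q' U' qq' oU' qU'.
have nU : nbhs p [set s : Xi_product R T | U (s L)].
  exact: (@proj_continuous (nonempty_subset T) _ L p _ (open_nbhs_nbhs (conj oU Up))).
have nV : nbhs p [set s : Xi_product R T | V (s M)].
  exact: (@proj_continuous (nonempty_subset T) _ M p _ (open_nbhs_nbhs (conj oV pV))).
have [_ [[x _ <-] [/UU' + Vx]]] := pP _ (filterI nU nV).
have -> : Xi_pullback (elt_incl ML)
            (Xi_pullback (fun i : elt (val L) => val i) x) =
          Xi_pullback (fun i : elt (val M) => val i) x.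
  by rewrite -[x]Xi_reprK !Xi_pullback_pi.
by move=> U'x; move: VU'; rewrite -subset0; apply; split; [exact: Vx|exact: U'x].
Qed.

Lemma Pass_finite (p : Xi_product R T) (L M : nonempty_subset T) g :
  Pass R T p -> val M \subset val L -> finite_at (p L) g -> finite_at (p M) g.
Proof.
move=> pP ML pL; apply: (Pass_restrict (ML := ML) pP).
by rewrite pL rst_pullback.
Qed.

Lemma Pass_infinite (p : Xi_product R T) (L M : nonempty_subset T) g :
  Pass R T p -> val M \subset val L -> infinite_at (p L) g ->
  rst (val M) g != 0 -> infinite_at (p M) g.
Proof.
move=> pP ML [g0 pL] gM0; exists gM0; apply: (Pass_restrict (ML := ML) pP).
rewrite pL; exists (rst (val L) g); first exact: ray_mem.
by move: gM0; rewrite -(rst_pullback ML) => gM0; exists gM0.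
Qed.

End Restriction.

(** * Pairs of points separated by an element of a tree-partition *)

Section TreeCombinatorics.
Variables (T : finType) (A : {set {set T}}) (treeA : tree_partition A).
Implicit Types (B K L : {set T}).

(** For points of a reducible [K] in [A] this means lying in different blocks of [min_decomp A K];
    this form avoids the quotient and compares directly with level sets. *)
Definition split_by K : rel T :=
  fun x y => ~~ [exists B in A, [&& B \proper K, x \in B & y \in B]].

(** An element properly inside [K] that contains both points is comparable with the block of [x] by
    laminarity, hence inside it by maximality. *)
Lemma split_by_pblock K x y : K \in A -> ~~ irreducible_elt A K ->
  x \in K -> y \in K ->
  split_by K x y =
    (finset.pblock (min_decomp A K) x != finset.pblock (min_decomp A K) y).
Proof.
move=> KA red xK yK; have part := min_decomp_partition treeA KA red.
have xc : x \in finset.cover (min_decomp A K) by rewrite (cover_partition part).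
congr negb; apply/exists_inP/eqP => [[B BA /and3P [BK xB yB]]|xy].
  have /min_decompP [CA CK Cmax] := pblock_mem xc.
  have xC : x \in finset.pblock (min_decomp A K) x by rewrite mem_pblock.
  have yC : y \in finset.pblock (min_decomp A K) x.
    case: (tree_laminar_meet treeA BA CA xB xC) => [BC|CB].
      exact: (fintype.subsetP BC).
    by rewrite -(Cmax B BA BK CB).
  by rewrite (same_pblock (partition_trivIset part) yC).
have /min_decompP [CA CK _] := pblock_mem xc.
exists (finset.pblock (min_decomp A K) x) => //; rewrite CK mem_pblock xc /=.
by rewrite xy mem_pblock (cover_partition part).
Qed.

Lemma min_elt_split L : L != finset.set0 ->
  ~~ irreducible_elt A (min_elt A L) ->
  exists x y, [/\ x \in L, y \in L & split_by (min_elt A L) x y].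
Proof.
move=> L0 red; have [x [y /=]] := min_elt_meets_two_blocks treeA L0 red.
rewrite -val_eqE /= => xy; exists (val x), (val y).
have LK := min_elt_subset treeA L.
rewrite split_by_pblock ?(valP x) ?(valP y) //.
- exact: min_elt_mem.
- exact: (fintype.subsetP LK _ (valP x)).
- exact: (fintype.subsetP LK _ (valP y)).
Qed.

Lemma min_elt_id K : K \in A -> K != finset.set0 -> min_elt A K = K.
Proof.
move=> KA K0; apply/eqP; rewrite finset.eqEsubset (min_elt_sub treeA K0 KA) //.
exact: min_elt_subset.
Qed.

End TreeCombinatorics.

Lemma image_set_inj (X Y : Type) (f : X -> Y) :
  injective f -> injective (fun A => f @` A).
Proof.
move=> f_inj A B AB; apply/funext => x.
by rewrite -(@image_inj _ _ f A x f_inj) AB image_inj.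
Qed.

(** * Coordinates of a stratum as functions on [T] *)

Section Represents.
Variables (R : realType) (T : finType).
Implicit Types (A : {set {set T}}) (B K L : {set T}) (g : T -> R).

(** The boolean is a parameter because [stratum_factor] is an [if] between types: case analysis on
    [b] then reduces the type of [u]. *)
Definition represents_branch A K (b : bool) :
    (if b then Xi R (elt K)
     else {r : sphere_at_infinity (Xi R (elt (min_decomp A K))) | generic_ray r}) ->
    (T -> R) -> Prop :=
  match b with
  | true => fun u g => u = rst K g
  | false => fun u g => exists2 f : funs R (elt (min_decomp A K)),
      injective f /\ sval (sval u) = ray (to_Xi f) &
      forall (B : elt (min_decomp A K)) x, x \in val B -> g x = f B
  end.

Definition represents A K (u : stratum_factor R A K) g : Prop :=
  represents_branch u g.

Lemma represents_ex A K (treeA : tree_partition A) (KA : K \in A)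
    (u : stratum_factor R A K) : exists g, represents u g.
Proof.
move: u; rewrite /represents /stratum_factor.
case: {-1}(irreducible_elt A K) (erefl (irreducible_elt A K)) => irr u /=.
  by have [g ->] := rst_surj u; exists g.
have part := min_decomp_partition treeA KA (negbT irr).
have [f f_inj uE] := svalP u.
(* A point outside [K] has no block and receives the default value 0. *)
exists (fun x => oapp f 0 (insub (finset.pblock (min_decomp A K) x))).
exists f => // B x xB.
by rewrite (def_pblock (partition_trivIset part) (valP B) xB) valK.
Qed.

Lemma represents_split A K (treeA : tree_partition A) (KA : K \in A)
    (u : stratum_factor R A K) g x y :
  represents u g -> ~~ irreducible_elt A K -> x \in K -> y \in K ->
  (g x != g y) = split_by A K x y.
Proof.
move=> + red xK yK; rewrite split_by_pblock //.
have part := min_decomp_partition treeA KA red.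
move: u; rewrite /represents /stratum_factor (negbTE red) => u [f [f_inj _] gf].
pose B z zK : elt (min_decomp A K) := quotient_map part (exist _ z zK : elt K).
have gB z zK : g z = f (B z zK).
  by apply: gf; rewrite /= mem_pblock (cover_partition part).
by rewrite (gB x xK) (gB y yK) (inj_eq f_inj) -val_eqE.
Qed.

Lemma represents_irreducible_ex A K g : irreducible_elt A K ->
  exists u : stratum_factor R A K, represents u g.
Proof.
rewrite /represents /stratum_factor => ->.
by exists (rst K g).
Qed.

Lemma represents_reducible_ex A K (treeA : tree_partition A) (KA : K \in A) g :
  ~~ irreducible_elt A K -> rst K g != 0 ->
  (forall x y, x \in K -> y \in K -> (g x != g y) = split_by A K x y) ->
  exists u : stratum_factor R A K, represents u g.
Proof.
move=> red g0 gsplit; rewrite /represents /stratum_factor (negbTE red).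
have part := min_decomp_partition treeA KA red.
have rep (B : elt (min_decomp A K)) : exists x : elt K, quotient_map part x = B.
  exact: quotient_map_surj.
pose f (B : elt (min_decomp A K)) : R := g (val (projT1 (cid (rep B)))).
have f_inj : injective f.
  move=> B C; rewrite /f; case: cid => /= x xB; case: cid => /= y yC /eqP gxy.
  rewrite -xB -yC; apply: val_inj => /=; apply/eqP.
  have := gsplit _ _ (valP x) (valP y); rewrite gxy /=.
  by rewrite (split_by_pblock treeA) ?(valP x) ?(valP y) // => /esym/negbFE.
have gf (B : elt (min_decomp A K)) x : x \in val B -> g x = f B.
  move=> xB; rewrite /f; case: cid => /= y yB; apply/eqP/negPn.
  have xK : x \in K by exact: (fintype.subsetP (partitionS part (valP B))).
  rewrite gsplit ?(valP y) // (split_by_pblock treeA) ?(valP y) // negbK.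
  move: (congr1 val yB) => /= ->.
  by rewrite (def_pblock (partition_trivIset part) (valP B) xB).
have f0 : to_Xi (f : funs R (elt (min_decomp A K))) != 0.
  apply: contra g0 => /eqP f0.
  have -> : rst K g = Xi_embed R part (to_Xi (f : funs R (elt (min_decomp A K)))).
    rewrite /Xi_embed /= Xi_pullback_pi /rst; congr to_Xi; apply/funext => x /=.
    by apply: gf; rewrite /= mem_pblock (cover_partition part) (valP x).
  by rewrite f0 linear0.
have genf : generic_ray (ray_at f0) by exists f.
by exists (exist _ (ray_at f0) genf); exists f.
Qed.

(** In the reducible case, embedding followed by restriction is pullback along the map from [L] to
    the blocks, and [g] takes at a point the value of [f] at its block. *)
Lemma iota_branch_represents (A : treepart T) L (L0 : L != finset.set0) b
    (e : irreducible_elt (sval A) (min_elt (sval A) L) = b)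
    (u : if b then Xi R (elt (min_elt (sval A) L))
         else {r : sphere_at_infinity
                     (Xi R (elt (min_decomp (sval A) (min_elt (sval A) L))))
              | generic_ray r}) g :
  represents_branch u g ->
  if b then finite_at (iota_branch L0 e u) g
  else infinite_at (iota_branch L0 e u) g.
Proof.
case: b e u => e u /= => [->|[f [f_inj uE] gf]].
  by rewrite /finite_at /iota_irreducible; congr FinitePoint; exact: Xi_pullback_pi.
have sE : sval (sphere_map
    (@restrict_neq0 R T A L L0 (negbT e) (sval u) (svalP u))) = ray (rst L g).
  rewrite /= uE /sphere_embed !image_ray; congr ray.
  rewrite /Xi_restrict /Xi_embed /= (Xi_pullback_pi _ f) Xi_pullback_pi /rst.
  congr to_Xi.
  apply/funext => x /=; apply/esym/gf => /=.
  have part := min_decomp_partition (svalP A) (min_elt_mem (svalP A) L) (negbT e).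
  rewrite mem_pblock (cover_partition part).
  exact: (fintype.subsetP (min_elt_subset (svalP A) L) _ (valP x)).
have [g0 sE'] := sphere_ray sE; exists g0.
by rewrite /iota_reducible sE'.
Qed.

Lemma iota_represents (A : treepart T) L (L0 : L != finset.set0)
    (u : stratum_factor R (sval A) (min_elt (sval A) L)) g : represents u g ->
  if irreducible_elt (sval A) (min_elt (sval A) L)
  then finite_at (iota_component L0 u) g
  else infinite_at (iota_component L0 u) g.
Proof. exact: iota_branch_represents. Qed.

Lemma Xi_pullback_inj (I K : Type) (phi : K -> I) :
  (forall i, exists k, phi k = i) -> injective (@Xi_pullback R _ _ phi).
Proof.
move=> phi_surj x y /eqP; rewrite -subr_eq0 -linearB => xy.
apply/eqP; rewrite -subr_eq0; apply: contraTT xy.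
exact: Xi_pullback_surj.
Qed.

(** Here [L] equals its minimal element, so restriction is injective; embedding is injective because
    the quotient map is surjective, and injective maps induce injective maps on rays. *)
Lemma iota_branch_inj (A : treepart T) L (L0 : L != finset.set0) b
    (e : irreducible_elt (sval A) (min_elt (sval A) L) = b) :
  min_elt (sval A) L \subset L -> injective (iota_branch (R := R) L0 e).
Proof.
move=> KL.
have inj_r : injective (Xi_restrict R (min_elt_subset (svalP A) L)).
  apply: Xi_pullback_inj => -[x xK].
  by exists (exist _ x (fintype.subsetP KL x xK)); exact: val_inj.
case: b e => e u v /= [].
  exact: inj_r.
move=> uv.
have inj_e (red : ~~ irreducible_elt (sval A) (min_elt (sval A) L)) :
    injective (Xi_embed R (min_decomp_partition (svalP A)
      (min_elt_mem (svalP A) L) red)).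
  by apply: Xi_pullback_inj; exact: quotient_map_surj.
case: u v uv => u Gu [v Gv] /= [] /(image_set_inj inj_r) /(image_set_inj (inj_e _)) uv.
have {}uv : u = v by exact: sphere_eq.
by subst v; congr exist; exact: Prop_irrelevance.
Qed.

End Represents.

(** * Intrinsic description of the points of a stratum *)

Section Stratification.
Variables (R : realType) (T : finType).
Implicit Types (A : {set {set T}}) (B K L M : {set T}) (p : Xi_product R T).

Lemma infinite_at_inj K (q q' : compactification (Xi R (elt K))) g :
  infinite_at q g -> infinite_at q' g -> q = q'.
Proof.
by move=> [g0 ->] [g0' ->]; congr (InfinitePoint (ray_at _)); exact: Prop_irrelevance.
Qed.

(** Membership of [p] in the image of the stratum of [A], with [G K] standing for the coordinate
    [u K]; [iota_stratified] and [stratified_iota] translate both ways. *)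
Record stratified p A (G : {set T} -> T -> R) : Prop := Stratified {
  stratified_split : forall K x y, K \in A -> ~~ irreducible_elt A K ->
    x \in K -> y \in K -> (G K x != G K y) = split_by A K x y;
  stratified_at : forall L : nonempty_subset T,
    let K := min_elt A (val L) in
    if irreducible_elt A K then finite_at (p L) (G K)
    else infinite_at (p L) (G K) }.

Lemma iota_stratified (At : treepart T) (u : Str R At) :
  exists G, stratified (iota_Str R At u) (sval At) G.
Proof.
pose treeA := svalP At.
have /choice [h hu] : forall K : elt (sval At), exists g, represents (u K) g.
  by move=> K; exact: represents_ex (valP K) (u K).
pose G K :=
  if pselect (K \in sval At) is left KA then h (exist _ K KA) else fun=> 0.
have hE K (KA : K \in sval At) : h (exist _ K KA) = G K.
  rewrite /G; case: pselect => // KA'.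
  by congr (h (exist _ _ _)); exact: bool_irrelevance.
exists G; split=> [K x y KA red xK yK|L K].
  rewrite -(hE K KA).
  exact: (@represents_split R T _ K treeA KA _ _ x y (hu (exist _ K KA))).
have := iota_represents (valP L) (hu (exist _ K (min_elt_mem treeA (val L)))).
by rewrite hE; exact.
Qed.

Lemma stratified_iota (At : treepart T) p G :
  stratified p (sval At) G -> exists u, iota_Str R At u = p.
Proof.
pose treeA := svalP At; move=> [splitG pG].
have u_ex : forall K : elt (sval At),
    exists u : stratum_factor R (sval At) (val K), represents u (G (val K)).
  move=> [K KA] /=; have [irr|red] := boolP (irreducible_elt (sval At) K).
    exact: represents_irreducible_ex.
  have K0 := tree_neq0 treeA KA; have KE := min_elt_id treeA KA K0.
  have := pG (exist _ K K0); rewrite /= KE (negbTE red) => -[GK0 _].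
  by apply: represents_reducible_ex => // x y; exact: splitG.
pose u (K : elt (sval At)) := projT1 (cid (u_ex K)).
have uG (K : elt (sval At)) : represents (u K) (G (val K)) := projT2 (cid (u_ex K)).
exists u; apply/functional_extensionality_dep => L.
have := iota_represents (valP L)
  (uG (exist _ (min_elt (sval At) (val L)) (min_elt_mem treeA (val L)))).
have := pG L; rewrite /=; case: (irreducible_elt _ _) => pL uL.
  exact: etrans uL (esym pL).
exact: infinite_at_inj uL pL.
Qed.

Definition level_block p K : Prop :=
  K != finset.set0 /\
  forall L : nonempty_subset T, K \proper val L ->
    exists2 g, infinite_at (p L) g & {in K &, forall x y, g x = g y}.

(** An element of [A] lies in one block of each larger element [M], so [G M] is constant on it. A
    nonempty [K] outside [A] is properly contained in its minimal element, whose function separates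
    two points of [K]. Thus [p] determines [A]. *)
Lemma stratified_mem p A G K : tree_partition A -> stratified p A G ->
  K \in A <-> level_block p K.
Proof.
move=> treeA [splitG pG]; split=> [KA|[K0 Klev]].
  split=> [|L KL]; first exact: tree_neq0 KA.
  set M := min_elt A (val L).
  have LM : val L \subset M := min_elt_subset treeA _.
  have KM : K \proper M := proper_sub_trans KL LM.
  have red : ~~ irreducible_elt A M.
    by rewrite negbK; apply/exists_inP; exists K.
  exists (G M); first by have /= := pG L; rewrite -/M (negbTE red).
  move=> x y xK yK; have KsM := fintype.subsetP (proper_sub KM).
  apply/eqP; rewrite -[_ == _]negbK splitG ?KsM //; last exact: min_elt_mem.
  by rewrite negbK; apply/exists_inP; exists K; rewrite ?KM ?xK.
apply: contrapT => /negP KA; set M := min_elt A K.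
have MA : M \in A := min_elt_mem treeA K.
have KM : K \proper M.
  rewrite finset.properEneq (min_elt_subset treeA K) andbT.
  by apply: contraNneq KA => ->.
have M0 : M != finset.set0 := tree_neq0 treeA MA.
have [g pg gK] := Klev (exist _ M M0) KM.
have := pG (exist _ M M0); rewrite /= (min_elt_id treeA MA M0).
case: ifPn => [_ pM|red pM]; first exact: finite_infinite_at pM pg.
have [x [y [xK yK]]] := min_elt_split treeA K0 red.
have KsM := fintype.subsetP (proper_sub KM).
rewrite -splitG ?KsM // => /eqP; apply.
exact: (infinite_at_level pg pM (KsM _ xK) (KsM _ yK) (gK _ _ xK yK)).
Qed.

(** * The tree-partition of a point of [Pass] *)

Section PassPoint.
Variables (p : Xi_product R T) (pP : Pass R T p).

(** Let [L] properly contain the fiber. If [L] lies in [M], then [g] is nonconstant on [L] and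
    restricts to it. Otherwise the function at [L :|: M] is constant on [M]; as [L] meets [M], it is
    nonconstant on [L] and restricts to it. *)
Lemma level_block_fiber M (M0 : M != finset.set0) g b :
  level_block p M -> infinite_at (p (exist _ M M0)) g -> b \in M ->
  level_block p (finset (fun x => (x \in M) && (g x == g b))).
Proof.
move=> [_ Mlev] pM bM; set B := finset _.
have BM : B \subset M by apply/fintype.subsetP => x; rewrite inE => /andP [].
have bB : b \in B by rewrite inE bM eqxx.
split=> [|L BL]; first by apply/set0Pn; exists b.
have bL : b \in val L := fintype.subsetP (proper_sub BL) _ bB.
have [LM|LM] := boolP (val L \subset M).
  exists g => [|x y]; last by rewrite !inE => /andP [_ /eqP ->] /andP [_ /eqP ->].
  apply: (Pass_infinite pP _ pM) => //; apply/rst_neq0P.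
  have [_ [z zL]] := properP BL.
  rewrite inE (fintype.subsetP LM) //= => /eqP gz.
  by exists z, b.
have LM0 : val L :|: M != finset.set0 by apply/set0Pn; exists b; rewrite inE bM orbT.
have MLM : M \proper val L :|: M.
  by rewrite fintype.properE finset.subsetUr finset.subUset subxx andbT.
have [w pw wM] := Mlev (exist _ (val L :|: M) LM0) MLM.
exists w => [|x y xB yB]; last by apply: wM; exact: (fintype.subsetP BM).
apply: (Pass_infinite pP _ pw) => /=; first exact: finset.subsetUl.
case: pw => /= w0 _; apply/rst_neq0P.
apply: contrapT => cstw.
have wb z : z \in val L :|: M -> w z = w b.
  rewrite inE => /orP [zL|zM]; last exact: wM.
  by apply: contrapT => wz; apply: cstw; exists z, b.
have /rst_neq0P [x [y [xU yU]]] := w0; apply.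
by rewrite !wb.
Qed.

(** If neither set contained the other, a function for the ray at [K :|: L] would be constant on
    both, hence on the union since they share a point. *)
Lemma level_block_laminar K L :
  level_block p K -> level_block p L -> ~~ [disjoint K & L] ->
  K \subset L \/ L \subset K.
Proof.
move=> [K0 Klev] [L0 Llev] KL.
have KL0 : K :|: L != finset.set0.
  by have /set0Pn [x xK] := K0; apply/set0Pn; exists x; rewrite inE xK.
have [LK|LK] := boolP (L \subset K); first by right.
have [KsL|KsL] := boolP (K \subset L); first by left.
have KU : K \proper K :|: L.
  by rewrite fintype.properE finset.subsetUl finset.subUset subxx.
have LU : L \proper K :|: L.
  by rewrite fintype.properE finset.subsetUr finset.subUset subxx andbT.
have [g pg gK] := Klev (exist _ (K :|: L) KL0) KU.
have [h ph hL] := Llev (exist _ (K :|: L) KL0) LU.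
have [z zK zL] : exists2 z, z \in K & z \in L.
  move: KL; rewrite -finset.setI_eq0 => /set0Pn [z]; rewrite inE => /andP [? ?].
  by exists z.
have zU : z \in K :|: L by rewrite inE zK.
have gL x : x \in L -> g x = g z.
  move=> xL; apply: (infinite_at_level ph pg _ zU (hL x z xL zL)).
  by rewrite inE xL orbT.
case: pg => /rst_neq0P [u [v [uU vU guv]]] _.
have gU t : t \in K :|: L -> g t = g z.
  by rewrite inE => /orP [tK|/gL//]; exact: gK.
by case: guv; rewrite !gU.
Qed.

Definition level_blocks : {set {set T}} := finset (fun K => `[< level_block p K >]).

Lemma level_blocksP K : reflect (level_block p K) (K \in level_blocks).
Proof. by rewrite inE; exact: asboolP. Qed.

(** Take a minimal level block [M] containing [K] and [x], and the fiber of [x] at [M]. If it met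
    [K], it would contain [K], so by minimality it would be [M], and the function at [M] would be
    constant. *)
Lemma level_block_cover K I x : level_block p K -> level_block p I ->
  K \subset I -> x \in I -> x \notin K ->
  exists B, [/\ level_block p B, B \subset I, [disjoint B & K]%B & x \in B].
Proof.
move=> Klev Ilev KI xI xK.
pose Q := fun C : {set T} => [&& C \in level_blocks, K \subset C & x \in C].
have QI : Q I by rewrite /Q KI xI !andbT; apply/level_blocksP.
have [M /minsetP [/and3P [/level_blocksP Mlev KM xM] Mmin] MI] := minset_exists QI.
have KpM : K \proper M by apply/properP; split=> //; exists x.
have M0 := Mlev.1; have [g pg gK] := Klev.2 (exist _ M M0) KpM.
have Blev := level_block_fiber Mlev pg xM.
exists (finset (fun y => (y \in M) && (g y == g x))); split=> //.
- by apply/fintype.subsetP => y; rewrite inE => /andP [/(fintype.subsetP MI)].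
- rewrite -finset.setI_eq0; apply/eqP/finset.setP => z; rewrite !inE.
  apply/negP => /andP [/andP [zM /eqP gz] zK].
  have BM : finset (fun y => (y \in M) && (g y == g x)) = M.
    apply: Mmin; last by apply/fintype.subsetP => y; rewrite inE => /andP [].
    rewrite /Q inE xM eqxx !andbT; apply/andP; split; first exact/level_blocksP.
    apply/fintype.subsetP => y yK; rewrite inE (fintype.subsetP KM) //=.
    by rewrite -gz (gK y z).
  case: pg => /= /rst_neq0P [y [w [yM wM]]] + _; case.
  have gM t : t \in M -> g t = g x by rewrite -{1}BM inE => /andP [_ /eqP].
  by rewrite !gM.
- by rewrite inE xM /=.
Qed.

Lemma tree_level_blocks : finset.setT != finset.set0 :> {set T} ->
  tree_partition level_blocks.
Proof.
move=> T0; split=> [K /level_blocksP [] //||I K|I K].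
- apply/level_blocksP; split=> // L.
  by rewrite fintype.properE finset.subsetT andbF.
- move=> /level_blocksP Ilev /level_blocksP Klev.
  have [IK|IK] := boolP [disjoint I & K]; first by constructor 1.
  by have [|] := level_block_laminar Ilev Klev IK; [constructor 2|constructor 3].
- move=> /level_blocksP Ilev /level_blocksP Klev KI.
  pose Q := fun C : {set T} =>
    [&& C \in level_blocks, C \subset I & [disjoint C & K]%B].
  have KsI := proper_sub KI.
  (* The maximal level blocks in [I] disjoint from [K] cover the rest of [I] by [level_block_cover]
     and are pairwise disjoint by laminarity. *)
  exists (K |: finset (fun C => maxset Q C)); split.
  + apply/fintype.subsetP => B; rewrite in_setU1 inE => /orP [/eqP ->|].
      exact/level_blocksP.
    by case/maxsetP => /and3P [].
  + by rewrite !inE eqxx.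
  + apply/and3P; split.
    * apply/eqP/finset.setP => x; apply/finset.bigcupP/idP => [[B]|xI].
        rewrite !inE => /orP [/eqP ->|]; first exact: (fintype.subsetP KsI).
        by case/maxsetP => /and3P [_ /fintype.subsetP BI _] _ /BI.
      have [xK|xK] := boolP (x \in K); first by exists K; rewrite // !inE eqxx.
      have [B [Blev BI BK xB]] := level_block_cover Klev Ilev KsI xI xK.
      have QB : Q B by rewrite /Q BI BK !andbT; apply/level_blocksP.
      have [C Cmax BC] := maxset_exists QB.
      by exists C; [rewrite !inE Cmax orbT | exact: (fintype.subsetP BC)].
    * apply/finset.trivIsetP => B C; rewrite !inE.
      case/orP => [/eqP ->|Bmax] /orP [/eqP ->|Cmax]; rewrite ?eqxx // => BC.
      - by case/maxsetP: Cmax => /and3P [_ _]; rewrite disjoint_sym.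
      - by case/maxsetP: Bmax => /and3P [].
      - apply: contraR BC => nd.
        case/maxsetP: Bmax => QB Bmax; case/maxsetP: Cmax => QC Cmax.
        case/and3P: (QB) => /level_blocksP Blev _ _.
        case/and3P: (QC) => /level_blocksP Clev _ _.
        by case: (level_block_laminar Blev Clev nd) => [/(Bmax _ QC) ->|/(Cmax _ QB) ->].
    * apply/negP; rewrite !inE => /orP [/eqP K0|/maxsetP [/and3P [/level_blocksP [B0]]]].
        by move: Klev.1; rewrite -K0 eqxx.
      by rewrite eqxx in B0.
Qed.

Lemma Pass_stratified : finset.setT != finset.set0 :> {set T} ->
  exists G, stratified p level_blocks G.
Proof.
move=> T0; have treeA := tree_level_blocks T0; pose A := level_blocks.
have /choice [h hp] : forall L : nonempty_subset T, exists g,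
    finite_at (p L) g \/ infinite_at (p L) g.
  by move=> L; exact: finite_or_infinite_at.
pose G K :=
  if pselect (K != finset.set0) is left K0 then h (exist _ K K0) else fun=> 0.
have GE (L : nonempty_subset T) : G (val L) = h L.
  case: L => K K0; rewrite /G; case: pselect => //= K0'.
  by congr (h (exist _ _ _)); exact: bool_irrelevance.
(* If [p] is infinite at [K], some fiber is a level block properly inside [K]; conversely such a
   level block forces [p] to be infinite at [K]. *)
have pG K (K0 : K != finset.set0) : K \in A ->
    if irreducible_elt A K then finite_at (p (exist _ K K0)) (G K)
    else infinite_at (p (exist _ K K0)) (G K).
  move=> /level_blocksP Klev.
  have := hp (exist _ K K0); rewrite -(GE (exist _ K K0)) /=.
  case: ifPn => [irr [//|pK]|red [pK|//]].
    have [x [y [xK yK gxy]]] : exists x y, [/\ x \in K, y \in K & G K x <> G K y].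
      by apply/rst_neq0P; case: pK.
    case/negP: irr; apply/exists_inP.
    exists (finset (fun z => (z \in K) && (G K z == G K x))).
      by apply/level_blocksP; exact: level_block_fiber pK xK.
    apply/properP; split; first by apply/fintype.subsetP => z; rewrite inE => /andP [].
    by exists y; rewrite // inE yK /=; apply/eqP => /esym/gxy.
  move: red; rewrite negbK => /exists_inP [B /level_blocksP [_ Blev] BK].
  have [g pg _] := Blev (exist _ K K0) BK.
  by case: (finite_infinite_at pK pg).
(* Points with equal values share a fiber, a level block that is proper because [G K] is
   nonconstant; conversely [G K] is constant on level blocks properly inside [K]. *)
have Gsplit K x y : K \in A -> ~~ irreducible_elt A K ->
    x \in K -> y \in K -> (G K x != G K y) = split_by A K x y.
  move=> KA red xK yK; have K0 := tree_neq0 treeA KA.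
  have := pG K K0 KA; rewrite (negbTE red) => pK.
  congr negb; apply/eqP/exists_inP =>
    [gxy|[B /level_blocksP [_ Blev] /and3P [BK xB yB]]].
    exists (finset (fun z => (z \in K) && (G K z == G K x))).
      apply/level_blocksP; apply: level_block_fiber pK xK; exact/level_blocksP.
    rewrite !inE xK yK -gxy !eqxx !andbT; apply/properP.
    split; first by apply/fintype.subsetP => z; rewrite inE => /andP [].
    case: pK => /rst_neq0P [u [v [uK vK uv]]] _.
    have [ux|ux] := eqVneq (G K u) (G K x); last by exists u; rewrite // inE uK.
    by exists v; rewrite // inE vK -ux /=; apply/eqP => /esym/uv.
  have [g pg gB] := Blev (exist _ K K0) BK.
  exact: infinite_at_level pg pK xK yK (gB _ _ xB yB).
(* The component at [L] is restricted from its minimal element; a ray survives because that element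
   splits two points of [L]. *)
exists G; split=> [//|L /=]; set K := min_elt A (val L).
have KA : K \in A := min_elt_mem treeA _.
have LK : val L \subset K := min_elt_subset treeA _.
have K0 := tree_neq0 treeA KA.
have := pG K K0 KA; case: ifPn => [_ pK|red pK].
  exact: (@Pass_finite R T p (exist _ K K0) L _ pP LK pK).
apply: (@Pass_infinite R T p (exist _ K K0) L _ pP LK pK); apply/rst_neq0P.
have [x [y [xL yL]]] := min_elt_split treeA (valP L) red.
rewrite -Gsplit ?(fintype.subsetP LK) // => /eqP xy.
by exists x, y.
Qed.

End PassPoint.
End Stratification.

(** * Limits along powers of [t] *)

Lemma cvg_expr_ratio (R : realType) (j k : nat) : (j < k)%N ->
  (fun t : R => t ^+ j / t ^+ k) @ +oo --> (0 : R).
Proof.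
move=> jk; apply/(@cvgr0Pnorm_lt R R^o) => e e0; near=> t.
have t1 : 1 < t by near: t; exact: nbhs_pinfty_gt.
have te : e^-1 < t by near: t; apply: nbhs_pinfty_gt; rewrite num_real.
have t0 : 0 < t by exact: lt_trans t1.
rewrite ger0_norm ?divr_ge0 ?exprn_ge0 ?ltW //.
rewrite ltr_pdivrMr ?exprn_gt0 //.
have et : 1 < e * t by rewrite -ltr_pdivrMl // mulr1.
case: k jk => // k; rewrite ltnS exprS mulrA => jk.
apply: le_lt_trans (ler_weXn2l (ltW t1) jk) _.
by rewrite ltr_pMl // exprn_gt0.
Unshelve. all: by end_near. Qed.

Lemma cvg_expr_pinfty (R : realType) (k : nat) : (0 < k)%N ->
  (fun t : R => t ^+ k) @ +oo --> +oo.
Proof.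
move=> k0; apply/cvgryPger => a a_real; near=> t.
have t1 : 1 <= t by near: t; exact: nbhs_pinfty_ge.
have ta : a <= t by near: t; exact: nbhs_pinfty_ge.
by apply: le_trans ta _; rewrite -{1}[t]expr1 ler_weXn2l.
Unshelve. all: by end_near. Qed.

Lemma cvg_InfinitePoint (R : realType) (V : preTopologicalLmodType R)
    (S : Type) (F : set_system S) {FF : Filter F} (w : S -> V) (r : S -> R)
    (v : V) (v0 : v != 0) :
  w @ F --> v -> r @ F --> +oo ->
  (fun s => FinitePoint (r s *: w s)) @ F --> InfinitePoint (ray_at v0).
Proof.
move=> wv roo U; rewrite nbhsE => -[W [[_ infW] Wv] WU].
have [[P Q] /= [Pv Qoo] PQ] := infW v v0 Wv.
have nPQ : F [set s | P (w s) /\ Q (r s)].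
  by apply: (@filterI S F FF (w @^-1` P) (r @^-1` Q)); [exact: wv | exact: roo].
apply: (@filterS S F FF _ _ _ nPQ) => s [Ps Qs].
by apply: WU; have [] := PQ (w s, r s) (conj Ps Qs).
Qed.

(** * Approximation of a point of a stratum by diagonal points *)

Section Approximation.
Variables (R : realType) (T : finType).
Variables (A : {set {set T}}) (treeA : tree_partition A).
Variable G : {set T} -> T -> R.
Hypothesis Gsplit : forall K x y, K \in A -> ~~ irreducible_elt A K ->
  x \in K -> y \in K -> (G K x != G K y) = split_by A K x y.

(** Strictly larger at a reducible element than at the elements properly inside it, so that its term
    dominates there; weight 0 leaves the irreducible terms unscaled. *)
Definition weight (K : {set T}) : nat :=
  if irreducible_elt A K then 0 else #|K|.

Definition approx (t : R) (x : T) : R :=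
  \sum_(K in A | x \in K) t ^+ weight K * G K x.

Definition approx_in (M : {set T}) (t : R) (x : T) : R :=
  \sum_(K in A | (x \in K) && (K \subset M)) t ^+ weight K * G K x.

(** By laminarity, a dropped term that contributes at a point of [M] has an index [K] properly
    containing [M]. It then contributes on all of [M], and [G K] is constant there, so it vanishes
    modulo constants. *)
Lemma rst_approx (L M : {set T}) t : M \in A -> L \subset M ->
  rst L (approx t) = rst L (approx_in M t).
Proof.
move=> MA /fintype.subsetP LM; apply/rst_eqP => x y /LM xM /LM yM.
have E z : approx t z = approx_in M t z +
    \sum_(K in A | (z \in K) && ~~ (K \subset M)) t ^+ weight K * G K z.
  rewrite /approx /approx_in (bigID (fun K : {set T} => K \subset M)) /=.
  by congr (_ + _); apply: eq_bigl => K; rewrite andbA.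
rewrite !E; set sx := \sum_(K in A | (x \in K) && _) _.
set sy := \sum_(K in A | (y \in K) && _) _; suff -> : sx = sy by ring.
have MsubK K z : K \in A -> ~~ (K \subset M) -> z \in M -> z \in K -> M \proper K.
  move=> KA KM zM zK; rewrite fintype.properE KM andbT.
  by case: (tree_laminar_meet treeA MA KA zM zK) => // KsM; rewrite KsM in KM.
have MsK (K : {set T}) : M \proper K -> {subset M <= K}.
  by move=> MK; apply/fintype.subsetP; exact: proper_sub.
apply: eq_big => [K|K /and3P [KA xK KM]].
  have [KA|//] := boolP (K \in A); have [//|KM /=] := boolP (K \subset M).
    by rewrite !andbF.
  rewrite !andbT; apply/idP/idP => [xK|yK].
    exact: (MsK _ (MsubK _ _ KA KM xM xK)).
  exact: (MsK _ (MsubK _ _ KA KM yM yK)).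
have MK := MsubK _ _ KA KM xM xK.
congr (_ * _); apply/eqP; rewrite -[_ == _]negbK Gsplit //; last exact: MsK MK _ yM.
  by rewrite negbK; apply/exists_inP; exists M; rewrite // MK xM.
by rewrite negbK; apply/exists_inP; exists M.
Qed.

Lemma approx_in_irreducible M t x : M \in A -> irreducible_elt A M -> x \in M ->
  approx_in M t x = G M x.
Proof.
move=> MA irr xM; rewrite /approx_in (big_pred1 M) ?/weight ?irr ?mul1r // => K /=.
apply/idP/eqP => [/and3P [KA _ KM]|->]; last by rewrite MA xM /=.
apply/eqP; rewrite finset.eqEproper KM /=; apply: contra irr => KpM.
by apply/exists_inP; exists K.
Qed.

Lemma cvg_approx_in_reducible M x : M \in A -> ~~ irreducible_elt A M -> x \in M ->
  (fun t => approx_in M t x / t ^+ weight M) @ +oo --> G M x.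
Proof.
move=> MA red xM.
(* The limit is written over the same indices as the sum: after division, the coefficient of [K]
   tends to 1 if [K = M] and to 0 otherwise. *)
have -> : G M x = \sum_(K in A | (x \in K) && (K \subset M)) (K == M)%:R * G K x.
  rewrite (bigD1 M) ?MA ?xM //= eqxx mul1r big1 ?addr0 // => K.
  by case/andP => _ /negbTE ->; rewrite mul0r.
under eq_fun do rewrite mulr_suml.
apply: cvgr_sum => K /and3P [KA xK KM].
under eq_fun do rewrite mulrAC.
apply: (@cvgMr_tmp R); have [->|KneM] := eqVneq K M; last first.
  apply: cvg_expr_ratio; rewrite /weight (negbTE red).
  have KpM : K \proper M by rewrite finset.properEneq KneM.
  have := proper_card KpM; case: ifP => // _; exact: leq_ltn_trans.
apply: cvg_trans (near_eq_cvg _) (@cvg_cst _ (1 : R) _ _ _).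
near=> t; have t0 : 0 < t by near: t; exact: nbhs_pinfty_gt.
by rewrite divff // expf_neq0 // gt_eqF.
Unshelve. all: by end_near. Qed.

End Approximation.

Lemma stratified_Pass (R : realType) (T : finType) (p : Xi_product R T) A G :
  tree_partition A -> stratified p A G -> Pass R T p.
Proof.
move=> treeA [Gsplit pG].
pose c t := Defs.diagonal (to_Xi (approx A G t)) : Xi_product R T.
suff cp : c @ +oo --> p.
  move=> B /cp nB; have [t Bt] : exists t, B (c t).
    exact: (@filter_ex R (pinfty_nbhs R) _ (c @^-1` B) nB).
  by exists (c t); split=> //; exists (to_Xi (approx A G t)).
apply: prod_topology_cvg => L.
set K := min_elt A (val L).
have KA : K \in A := min_elt_mem treeA _.
have LK : val L \subset K := min_elt_subset treeA _.
have cL t : c t L = FinitePoint (rst (val L) (approx_in A G K t)).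
  rewrite -(rst_approx treeA Gsplit t KA LK) /c /Defs.diagonal Xi_pullback_pi.
  by [].
change ((fun t => c t L) @ +oo --> p L); rewrite (funext cL).
(* In the irreducible case this coordinate of the curve is constant; in the reducible case it is,
   for [t > 0], a power of [t] times a vector with nonzero limit. *)
have := pG L; rewrite /= -/K; case: ifPn => [irr ->|red [v0 ->]].
  have E t : rst (val L) (approx_in A G K t) = rst (val L) (G K).
    apply/rst_eqP => x y /(fintype.subsetP LK) xK /(fintype.subsetP LK) yK.
    by rewrite !approx_in_irreducible.
  rewrite (funext (fun t => congr1 (@FinitePoint R (Xi R (elt (val L)))) (E t))).
  exact: cvg_cst.
have k0 : (0 < weight A K)%N.
  rewrite /weight (negbTE red) card_gt0; exact: tree_neq0 KA.
pose w t := rst (val L) (fun x => approx_in A G K t x / t ^+ weight A K).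
have wv : w @ +oo --> rst (val L) (G K).
  apply: (@to_Xi_cvg R (elt (val L)) _ _ _
    (fun t x => approx_in A G K t (val x) / t ^+ weight A K)) => -[x xL] /=.
  by apply: cvg_approx_in_reducible => //; exact: (fintype.subsetP LK).
have cinf := @cvg_InfinitePoint R (Xi R (elt (val L))) R (pinfty_nbhs R) _ w
  (fun t => t ^+ weight A K) _ v0 wv (cvg_expr_pinfty k0).
move=> U /cinf nU.
apply: (@filterS2 R (pinfty_nbhs R) _ _ _ _ _ (nbhs_pinfty_gt (num_real 0)) nU).
move=> t t0 /=; congr (U (FinitePoint _)).
rewrite /w /rst -to_XiZ; congr to_Xi; apply/funext => x.
have tk : t ^+ weight A K != 0 by rewrite expf_neq0 // gt_eqF.
exact: etrans (mulrC _ _) (divfK tk _).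
Qed.

Theorem theorem6p1 (R : realType) (n : nat) (n_ge1 : (1 <= n)%N) :
  [/\ forall A : treepart 'I_n, injective (iota_Str R A),
      trivIset setT (fun A : treepart 'I_n => range (iota_Str R A)) &
      Pass R 'I_n = (\bigcup_(A in setT) range (iota_Str R A))%classic].
Proof.
have T0 : finset.setT != finset.set0 :> {set 'I_n}.
  by apply/set0Pn; exists (Ordinal n_ge1); rewrite inE.
split.
- move=> A u v uv; apply/functional_extensionality_dep => -[K KA].
  have treeA := svalP A; have K0 := tree_neq0 treeA KA.
  have KE := min_elt_id treeA KA K0.
  (* The component at [K] recovers [u K], but [iota_Str] indexes it by the minimal element of [K];
     this equality identifies the two indices. *)
  have eK : exist _ (min_elt (sval A) K) (min_elt_mem (svalP A) K) =
            exist _ K KA :> elt (sval A) by exact: val_inj.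
  rewrite -eK.
  pose L : nonempty_subset 'I_n := exist _ K K0.
  apply: (@iota_branch_inj R _ A K (valP L) _ erefl); first by rewrite KE.
  exact: (congr1 (fun p : Xi_product R 'I_n => p L) uv).
- move=> A B _ _ [p [[u _ <-] [v _ vu]]].
  have [G uG] := iota_stratified u; have [H vH] := iota_stratified v.
  rewrite vu in vH; apply: eq_sig_hprop; first by move=> C; exact: Prop_irrelevance.
  (* Both tree-partitions consist of the level blocks of the common point. *)
  apply/finset.setP => K; apply/idP/idP.
    by move/(stratified_mem K (svalP A) uG)/(stratified_mem K (svalP B) vH).
  by move/(stratified_mem K (svalP B) vH)/(stratified_mem K (svalP A) uG).
- rewrite eqEsubset; split=> [p pP|_ [A _ [u _ <-]]].
    have [G pG] := Pass_stratified pP T0.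
    pose A : treepart 'I_n := exist _ _ (tree_level_blocks pP T0).
    by have [u uE] := @stratified_iota R _ A p G pG; exists A => //; exists u.
  have [G uG] := iota_stratified u.
  exact: stratified_Pass (svalP A) uG.
Qed.
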